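(* There exist a directed tree $V$, a Banach sequence space $X$ over $V$ (which can even be taken to be a Hilbert space), and a sequence of weights $\lambda=(\lambda_v)_{v\in V}\in\mathbb{K}^V$ such that the weighted backward shift $B_{\lambda}:X\longrightarrow X$ is a well-defined (continuous linear) operator and its restriction to its closed $B_\lambda$-invariant subspace of chain recurrent vectors, $B_{\lambda}\vert_{CR(B_{\lambda})}:CR(B_{\lambda})\longrightarrow CR(B_{\lambda})$, is not a chain recurrent operator. In particular, $B_{\lambda}$ can be constructed so that the subspace $CR(B_{\lambda})$ is infinite-dimensional while $CR(B_{\lambda}\vert_{CR(B_{\lambda})})=\{0_X\}$, where $0_X\in X$ is the zero-vector.
   Context: $\mathbb{K}$ denotes $\mathbb{R}$ or $\mathbb{C}$ and $\mathbb{N}=\{1,2,\dots\}$. Directed trees. A directed tree $(V,E)$ (or just $V$) is a connected directed graph consisting of a countable set of vertices $V$ and a set of directed edges $E\subset V\times V\setminus\{(v,v): v\in V\}$ such that: $V$ has no cycles; each vertex $v\in V$ has at most one parent, i.e. at most one vertex $w\in V$ with $(w,v)\in E$; and there is at most one vertex with no parent. For $v\in V$, $\mathrm{Chi}(v)=\{u\in V: (v,u)\in E\}$ is the set of children of $v$. Sequence spaces and shifts. $\mathbb{K}^V$ is the space of all sequences $f=(f(v))_{v\in V}$ with the product topology. A Banach sequence space over $V$ is a linear subspace $X\subset\mathbb{K}^V$ endowed with a Banach space topology for which the canonical embedding $X\hookrightarrow\mathbb{K}^V$ is continuous. For $\lambda=(\lambda_v)_{v\in V}\in\mathbb{K}^V$,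 the weighted backward shift $B_\lambda$ is formally defined by $[B_\lambda(f)](v)=\sum_{u\in\mathrm{Chi}(v)}\lambda_u f(u)$ for $f\in \mathbb{K}^V$, $v\in V$. It is well-defined on $X$ if it maps $X$ into itself (and then it is continuous on $X$ by the Closed Graph Theorem). Chain recurrence. Let $T:X\to X$ be a continuous linear operator on a Banach space $(X,\|\cdot\|)$. Given $\delta>0$, a finite sequence $(f_l)_{l=0}^m$ in $X$, with $m\in\mathbb{N}$, is a $\delta$-chain for $T$ from $f_0$ to $f_m$ if $\|f_l-T(f_{l-1})\|<\delta$ for every $1\leq l\leq m$. A vector $f\in X$ is chain recurrent for $T$ if for every $\delta>0$ there exists a $\delta$-chain for $T$ from $f$ to itself. $CR(T)$ denotes the set of chain recurrent vectors for $T$; it is always a closed $T$-invariant linear subspace of $X$, so $T\vert_{CR(T)}$ is a continuous linear operator on the Banach space $CR(T)$, and $CR(T\vert_{CR(T)})$ is its own set of chain recurrent vectors (all chains being contained in $CR(T)$). An operator $T$ is chain recurrent if $CR(T)=X$. *)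

(* Defs.v *)
From HB Require Import structures.
From mathcomp Require Import all_boot all_order all_algebra finmap complex.
From mathcomp Require Import all_classical all_reals all_analysis.
From mathcomp.analysis.showcase Require Import summability.
Import Order.TTheory GRing.Theory Num.Theory.
Import numFieldNormedType.Exports.

Set Implicit Arguments.
Unset Strict Implicit.
Unset Printing Implicit Defensive.

Local Open Scope classical_set_scope.
Local Open Scope ring_scope.

(* Connectedness is that of the underlying undirected graph; cycles are
   directed ones (a simple undirected cycle of length at least 3 in a graph
   where each vertex has at most one parent is automatically directed). *)
Record directed_tree := DirectedTree {
  vertex :> countType ;
  edge : rel vertex ;
  edge_irreflexive : irreflexive edge ;
  edge_connected : forall u v : vertex, exists p : seq vertex,
    path (fun a b => edge a b || edge b a) u p /\ last u p = v ;
  edge_acyclic : forall c : seq vertex, ucycle edge c -> c = [::] ;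
  parent_unique : forall v w w' : vertex, edge w v -> edge w' v -> w = w' ;
  root_unique : forall v v' : vertex,
    (forall w, ~~ edge w v) -> (forall w, ~~ edge w v') -> v = v' }.

Definition Chi (V : directed_tree) (v : V) : pred V := edge v.

(* A linear subspace of K^V with its own Banach space topology is presented as
   a Banach space together with its canonical (linear, injective) embedding. *)
Record banach_sequence_space (K : numFieldType) (V : Type) :=
  BanachSequenceSpace {
  bss_space :> completeNormedModType K ;
  coords : {linear bss_space -> (V -> K)} ;
  coords_inj : injective coords ;
  coords_continuous : continuous (coords : bss_space -> {ptws V -> K}) }.

(* theta is the conjugation of K: the identity when K is real. *)
Definition is_hilbert (K : numFieldType) (theta : K -> K)
    (X : completeNormedModType K) : Prop :=
  exists dot : {dot X for theta}, forall x : X, `|x| ^+ 2 = dot x x.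

(* Chi v may be infinite and carries no order, so its sums are unordered sums:
   limits along the directed set of the finite subsets of Chi v. *)
Definition is_weighted_backward_shift (K : numFieldType) (V : directed_tree)
    (X : banach_sequence_space K V) (lambda : V -> K) (B : X -> X) : Prop :=
  forall (f : X) (v : V),
    partial_sum (fun u : {u : V | Chi v u} =>
      lambda (val u) * coords X f (val u)) @ totally
    --> (coords X (B f) v : K).

HB.structure Definition ContinuousLinear (K : numFieldType)
    (X Y : normedModType K) :=
  {T of @GRing.Linear K X Y *:%R T & @Continuous X Y T}.

Notation "{ 'continuous_linear' X '->' Y }" := (@ContinuousLinear.type _ X Y)
  (at level 0, X at level 98, Y at level 98,
   format "{ 'continuous_linear'  X  '->'  Y }") : type_scope.

Section chain_recurrence.
Context {K : numFieldType} {X : normedModType K}.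

Definition delta_chain (T : X -> X) (delta : K) (m : nat) (f : nat -> X) :=
  (0 < m)%N /\
  forall l : nat, (1 <= l <= m)%N -> `|f l - T (f l.-1)| < delta.

Definition CR (T : X -> X) : set X :=
  [set f | forall delta : K, 0 < delta -> exists (m : nat) (c : nat -> X),
    [/\ delta_chain T delta m c, c 0%N = f & c m = f]].

Definition chain_recurrent_operator (T : X -> X) : Prop := CR T = setT.

Lemma CR_periodic (T : X -> X) (f : X) : CR T f <->
  forall delta : K, 0 < delta -> exists (m : nat) (c : nat -> X),
    [/\ (0 < m)%N, c 0%N = f, forall k j, c (k + j * m)%N = c k &
        forall k, `|c k.+1 - T (c k)| < delta].
Proof.
split=> H d d0; have [m [c]] := H d d0.
- case=> -[m0 hc] c0 cm; exists m, (fun k => c (k %% m)%N); split => //.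
  + by rewrite mod0n.
  + by move=> k j; rewrite addnC modnMDl.
  + move=> k; have km := ltn_pmod k m0.
    have := hc (k %% m).+1 km; rewrite /=.
    have -> : (k.+1 %% m = (k %% m).+1 %% m)%N.
      by rewrite -[in LHS]addn1 -modnDml addn1.
    have [km1|] := ltnP (k %% m).+1 m; first by rewrite (modn_small km1).
    move=> mk; have -> : (k %% m).+1 = m by apply/eqP; rewrite eqn_leq mk km.
    by rewrite modnn cm c0.
- case=> m0 c0 cp hc; exists m, c; split => //; last first.
    by rewrite -c0 -(cp 0%N 1%N) add0n mul1n.
  by split=> // -[|l] // _; exact: hc.
Qed.

End chain_recurrence.

(* CR T is made a normed module in its own right, so that the chains of
   CR_restr T are by construction contained in CR T. *)
Section chain_recurrent_subspace.
Context {K : numFieldType} {X : normedModType K}.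
Variable T : {continuous_linear X -> X}.

Let T_continuous : continuous (T : X -> X).
Proof. exact: cts_fun. Qed.

Lemma CR_submod_closed : submod_closed (fun f : X => f \in CR T).
Proof.
split.
  rewrite unfold_in inE; apply/CR_periodic => d d0; exists 1%N, (fun=> 0); split => // k.
  by rewrite linear0 subr0 normr0.
move=> a u v; rewrite !unfold_in !inE => /CR_periodic hu /CR_periodic hv.
apply/CR_periodic => d d0.
have a1 : 0 < `|a| + 1 by rewrite ltr_wpDl.
have [|m [c [m0 c0 cp hc]]] := hu (d / 2 / (`|a| + 1)).
  by rewrite !divr_gt0.
have [|n [e [n0 e0 ep he]]] := hv (d / 2); first by rewrite divr_gt0.
exists (m * n)%N, (fun k => a *: c k + e k); split.
- by rewrite muln_gt0 m0.
- by rewrite c0 e0.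
- by move=> k j; rewrite mulnA ep -mulnA mulnC -mulnA mulnC cp.
- move=> k; rewrite linearD linearZ opprD addrACA -scalerBr.
  rewrite (le_lt_trans (ler_normD _ _))// [ltRHS](splitr d) ler_ltD//.
  rewrite normrZ (@le_trans _ _ ((`|a| + 1) * `|c k.+1 - T (c k)|))//.
    by rewrite ler_wpM2r// lerDl.
  by rewrite mulrC -ler_pdivlMr// ltW.
Qed.

Lemma CR_invariant (f : X) : CR T f -> CR T (T f).
Proof.
move=> hf d d0.
have : \forall x \near (0 : X), `|T x| < d.
  have := T_continuous (x := 0); rewrite /continuous_at linear0 => /cvgr0Pnorm_lt; exact.
move=> /nbhs_ballP[r /= r0 hr].
have [m [c [[m0 hc] c0 cm]]] := hf r r0.
exists m, (T \o c); split => /=; rewrite ?c0 ?cm//.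
split=> // l lm; rewrite /= -linearB; apply: hr.
by rewrite -ball_normE/= sub0r normrN; exact: hc.
Qed.

Lemma CR_closed : closed (CR T).
Proof.
move=> f clf d d0.
have d3 : 0 < d / 3 by rewrite divr_gt0.
have : \forall x \near (0 : X), `|x| < d / 3 /\ `|T x| < d / 3.
  near=> x; split; near: x.
    by have /cvgr0Pnorm_lt := @cvg_id _ (nbhs (0 : X)); exact.
  have := T_continuous (x := 0); rewrite /continuous_at linear0 => /cvgr0Pnorm_lt; exact.
move=> /nbhs_ballP[r /= r0 hr].
have [g [/(_ _ d3)[m [c [[m0 hc] c0 cm]]] fg]] := clf _ (nbhsx_ballx f r r0).
have [fg1 fg2] : `|f - g| < d / 3 /\ `|T (f - g)| < d / 3.
  by apply: hr; rewrite -ball_normE/= sub0r normrN; move: fg; rewrite -ball_normE.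
exists m, (fun k => c k + (f - g)).
split; [|by rewrite c0 addrC subrK|by rewrite cm addrC subrK].
split=> // l lm; rewrite linearD opprD addrACA.
have -> : d = d / 3 + (d / 3 + d / 3).
  by rewrite -!mulrDl -[X in d + X]mulr2n -mulrS -[d *+ 3]mulr_natr mulfK ?pnatr_eq0.
by rewrite (le_lt_trans (ler_normD _ _))// ltrD// ?hc//
  (le_lt_trans (ler_normB _ _))// ltrD.
Unshelve. all: by end_near. Qed.

Definition CR_space : Type := {f : X | f \in CR T}.

HB.instance Definition _ := [isSub of CR_space for @sval X _].
HB.instance Definition _ := [Choice of CR_space by <:].
HB.instance Definition _ := GRing.SubChoice_isSubLmodule.Build K X
  (fun f => f \in CR T) CR_space CR_submod_closed.

Let CR_norm (f : CR_space) : K := `|val f|.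

Let CR_normD f g : CR_norm (f + g) <= CR_norm f + CR_norm g.
Proof. exact: ler_normD. Qed.

Let CR_normZ (a : K) f : CR_norm (a *: f) = `|a| * CR_norm f.
Proof. exact: normrZ. Qed.

Let CR_norm_eq0 f : CR_norm f = 0 -> f = 0.
Proof. by move=> /normr0_eq0 f0; exact: val_inj. Qed.

HB.instance Definition _ := Lmodule_isNormed.Build K CR_space
  CR_normD CR_normZ CR_norm_eq0.

Lemma CR_space_normE (f : CR_space) : `|f| = `|val f|.
Proof. by []. Qed.

Lemma CR_restr_subproof (f : CR_space) : T (val f) \in CR T.
Proof. by rewrite inE; apply: CR_invariant; have := valP f; rewrite inE. Qed.

Definition CR_restr (f : CR_space) : CR_space :=
  Sub (T (val f)) (CR_restr_subproof f).

Let CR_restr_linear : linear CR_restr.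
Proof. by move=> a f g; apply: val_inj; rewrite /= linearP. Qed.

HB.instance Definition _ :=
  GRing.isLinear.Build K CR_space CR_space _ CR_restr CR_restr_linear.

Let CR_restr_continuous : continuous CR_restr.
Proof.
move=> f; apply/(@cvgrPdist_lt _ _ _ _ (nbhs_filter f)) => e e0.
have /cvgrPdist_lt/(_ _ e0)/nbhs_ballP[r /= r0 hr] := T_continuous (x := val f).
apply/nbhs_ballP; exists r => //= g; rewrite -ball_normE => fg.
by rewrite CR_space_normE; apply: hr; rewrite -ball_normE.
Qed.

HB.instance Definition _ :=
  isContinuous.Build CR_space CR_space CR_restr CR_restr_continuous.

End chain_recurrent_subspace.

Arguments CR_restr {K X} T f.

Section chain_recurrent_banach.
Context {K : numFieldType} {X : completeNormedModType K}.
Variable T : {continuous_linear X -> X}.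

Let CR_space_complete (F : set_system (CR_space T)) :
  ProperFilter F -> cauchy F -> cvg F.
Proof.
move=> FF cF.
have cG : cvg (val @ F).
  apply/cauchy_cvgP/cauchy_ballP => e e0; near_simpl.
  move/cauchy_ballP: cF => /(_ e e0); apply: filterS => -[x y] /=.
  by rewrite -!ball_normE.
have CRl : CR T (lim (val @ F)).
  apply: (closed_cvg (CR T) (CR_closed (T := T))) cG.
  by apply: nearW => x; have := valP x; rewrite inE.
apply/cvg_ex; exists (Sub (lim (val @ F)) (mem_set CRl)).
apply/cvgrPdist_lt => e e0; near=> x; rewrite CR_space_normE /=.
by near: x; move/cvgrPdist_lt : cG => /(_ e e0).
Unshelve. all: by end_near. Qed.

HB.instance Definition _ :=
  Uniform_isComplete.Build (CR_space T) CR_space_complete.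

End chain_recurrent_banach.

Definition finite_dimensional (K : numFieldType) (X : lmodType K) : Prop :=
  exists (n : nat) (b : 'I_n -> X),
    forall x : X, exists a : 'I_n -> K, x = \sum_(i < n) a i *: b i.

(* Main.v *)
Require Import Defs.
From HB Require Import structures.
From mathcomp Require Import all_boot all_order all_algebra finmap complex.
From mathcomp Require Import all_classical all_reals all_analysis.
From mathcomp.analysis.showcase Require Import summability.
From mathcomp Require Import ring.
Import Order.TTheory GRing.Theory Num.Theory.
Import numFieldNormedType.Exports.

Set Implicit Arguments.
Unset Strict Implicit.
Unset Printing Implicit Defensive.

Local Open Scope classical_set_scope.
Local Open Scope ring_scope.

(** The tree is an infinite comb: a spine (0,0), (1,0), (2,0), ..., and above
    each spine vertex (n,0) an infinite tooth (n,1), (n,2), ...  On the Hilbert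
    space of square summable families over it, the weights are 1/2 along the
    spine, 4 on the first n vertices of the n-th tooth, and 0 on the rest of
    that tooth.  Write T for the shift and e_v for the canonical unit vectors.

    The teeth make the spine chain recurrent.  Starting from a small multiple of
    e_(n,n), the shift multiplies it by 4 at each of the n steps down to the
    spine and by 1/2 at each of the n-m steps along the spine to (m,0).  The
    total factor is 4^n / 2^(n-m), which is unbounded in n, so a vector
    as small as one likes is carried exactly onto e_(m,0).  As
    T^(m+1) e_(m,0) = 0, the orbit of e_(m,0) reaches 0 and one small jump from
    there closes the chain (lemmas [CR_homoclinic] and
    [comb_spine_chain_recurrent]).

    The teeth themselves carry no chain recurrent vector.  Restricting a family
    to the n-th tooth intertwines T with a nilpotent operator, because of the
    zero weights; periodic chains of a nilpotent operator stay within a constant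
    times delta of 0, so a chain recurrent vector vanishes off the spine (lemma
    [CR_comb_shift_tooth]).

    Hence CR(T) is contained in the families supported by the spine, and it
    contains all the e_(m,0), so it is infinite-dimensional.  But on families
    supported by the spine only the weights 1/2 are seen: T is a strict
    contraction there, and a strict contraction has no chain recurrent vector
    but 0 (lemma [CR_contraction]).  The chains that came back to the spine
    had to use the teeth, which are outside CR(T).

    The real and the complex case are treated at once, over a field that has the
    few order and completeness properties needed to form l2. *)

#[local] Existing Instance totally_filter.

(** * Limits in a partially ordered field *)

Section cvg_numfield.
Context {K : numFieldType} {T : Type} {F : set_system T}.

Lemma cvg_sumr {FF : Filter F} (I : Type) (s : seq I) (f : I -> T -> K)
    (l : I -> K) : (forall i, f i x @[x --> F] --> l i) ->
  \sum_(i <- s) f i x @[x --> F] --> \sum_(i <- s) l i.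
Proof.
move=> fl; elim: s => [|i s IHs].
  by rewrite big_nil; under eq_fun do rewrite big_nil; exact: cvg_cst.
rewrite big_cons; under eq_fun do rewrite big_cons; exact: cvgD.
Qed.

(** In a numFieldType the order is partial, and x <= M is the negation of M < x
    only between real elements, hence the reality assumptions. *)
Lemma cvg_real_le {FF : ProperFilter F} (f : T -> K) (l M : K) :
  (forall x, f x \is Num.real) -> l \is Num.real -> M \is Num.real ->
  f x @[x --> F] --> l -> (\forall x \near F, f x <= M) -> l <= M.
Proof.
move=> fr lr Mr /cvgrPdist_lt fl fM; rewrite real_leNgt//.
apply/negP => Ml; have lM0 : 0 < l - M by rewrite subr_gt0.
have [x [lx xM]] := filter_ex (filterI (fl _ lM0) fM).
have : l - M <= `|l - f x|.
  by apply: le_trans (real_ler_norm _); [rewrite lerB|rewrite rpredB].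
by move=> /le_lt_trans/(_ lx); rewrite ltxx.
Qed.

End cvg_numfield.

(** * Scalars: the real and the complex numbers *)

(** What the construction of l2 and of its inner product uses of the scalars,
    common to the real and the complex numbers.  Norms are elements of K itself,
    so suprema and square roots are asked for the nonnegative elements of K. *)
Record hilbert_scalars (K : numFieldType) (theta : {rmorphism K -> K}) : Prop :=
  HilbertScalars {
  scalar_sup : forall (E : set K) (M : K), E !=set0 ->
    (forall x, E x -> 0 <= x) -> (forall x, E x -> x <= M) ->
    exists2 s, (forall x, E x -> x <= s) &
      (forall M', (forall x, E x -> x <= M') -> s <= M') ;
  scalar_sqrt : forall x : K, 0 <= x -> exists2 y, 0 <= y & y ^+ 2 = x ;
  scalar_complete : forall F : set_system K,
    ProperFilter F -> cauchy F -> cvg F ;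
  scalar_conjK : involutive theta ;
  scalar_normE : forall x : K, `|x| ^+ 2 = x * theta x }.

Section abstract_scalars.
Context {K : numFieldType} {theta : {rmorphism K -> K}}.
Hypothesis H : hilbert_scalars theta.

Lemma norm_conj (x : K) : `|theta x| = `|x|.
Proof.
apply/eqP; rewrite -(@eqrXn2 _ 2)// !(scalar_normE H) (scalar_conjK H).
by rewrite mulrC.
Qed.

(** The archimedean property, from the existence of suprema: half of the least
    upper bound of the powers of 2 would again be an upper bound. *)
Lemma exp2_unbounded (M : K) : 0 <= M -> exists n, M < 2 ^+ n.
Proof.
move=> M0; apply: contrapT => /forallNP small.
have bound x : range (fun n : nat => 2 ^+ n : K) x -> x <= M.
  move=> [n _ <-]; rewrite real_leNgt ?ger0_real ?exprn_ge0//.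
  exact/negP/small.
have [|x [n _ <-]|s sub slub] := scalar_sup H _ _ bound.
- by exists (2 ^+ 0); exists 0%N.
- by rewrite exprn_ge0.
have s0 : 0 < s by apply: lt_le_trans (sub 1 _) => //; exists 0%N.
have : s <= s / 2.
  apply: slub => x [n _ <-]; rewrite ler_pdivlMr// -exprSr.
  by apply: sub; exists n.+1.
by rewrite ler_pdivlMr// ger_pMr// (ler_nat _ 2 1).
Qed.

End abstract_scalars.

Section real_and_complex_scalars.
Variable R : realType.

Lemma real_sup (E : set R) (M : R) : E !=set0 -> (forall x, E x -> x <= M) ->
  exists2 s, (forall x, E x -> x <= s) &
    (forall M', (forall x, E x -> x <= M') -> s <= M').
Proof.
move=> E0 EM; exists (sup E).
  by move=> x Ex; apply: ub_le_sup => //; exists M.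
by move=> M' EM'; exact: ge_sup.
Qed.

Lemma real_hilbert_scalars : hilbert_scalars (K := R) idfun.
Proof.
split.
- by move=> E M E0 _; exact: real_sup.
- by move=> x x0; exists (Num.sqrt x); rewrite ?sqrtr_ge0 ?sqr_sqrtr.
- exact: R_complete.
- by [].
- by move=> x; rewrite real_normK ?num_real// expr2.
Qed.

Local Notation C := (R[i] : numFieldType).
Local Notation "x %:C" := (real_complex R x).

Lemma complex_nonneg (x : C) : 0 <= x -> x = (complex.Re x)%:C.
Proof. by case: x => a b; rewrite lecE/= => /andP[/eqP-> _]. Qed.

Lemma normc_ge_Im (x : C) : `|complex.Im x|%:C <= `|x|.
Proof. by rewrite normc_def lecR -sqrtr_sqr ler_wsqrtr// lerDr sqr_ge0. Qed.

Lemma normc_le_ReIm (x : C) :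
  `|x| <= (`|complex.Re x| + `|complex.Im x|)%:C.
Proof.
rewrite normc_def lecR; set a := complex.Re x; set b := complex.Im x.
have -> : `|a| + `|b| = Num.sqrt ((`|a| + `|b|) ^+ 2).
  by rewrite sqrtr_sqr [RHS]ger0_norm ?addr_ge0.
rewrite ler_wsqrtr// sqrrD !real_normK ?num_real// lerD2r lerDl.
by rewrite mulrn_wge0// mulr_ge0.
Qed.

(** The real and imaginary parts are 1-Lipschitz, so they carry a Cauchy filter
    to Cauchy filters of the reals. *)
Lemma complex_complete (F : set_system C) : ProperFilter F -> cauchy F -> cvg F.
Proof.
move=> FF /cauchy_ballP cF.
have cpart (p : C -> R) : (forall x y, `|p x - p y|%:C <= `|x - y|) ->
    cvg (p @ F).
  move=> plip; apply: R_complete; apply/cauchy_ballP => e e0; near_simpl.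
  have : 0 < e%:C :> C by rewrite ltcR.
  move=> /cF; apply: filterS => -[x y]; rewrite /= -!ball_normE/=.
  by move=> xy; rewrite -ltcR; exact: le_lt_trans (plip _ _) xy.
have /cvg_ex[a /cvgrPdist_lt Fa] : cvg (@complex.Re R @ F).
  apply: cpart => x y; rewrite -raddfB; exact: normc_ge_Re.
have /cvg_ex[b /cvgrPdist_lt Fb] : cvg (@complex.Im R @ F).
  apply: cpart => x y; rewrite -raddfB; exact: normc_ge_Im.
apply/cvg_ex; exists (a +i* b)%C; apply/cvgrPdist_lt => e e0.
have Re0 : 0 < complex.Re e / 2.
  rewrite divr_gt0// -ltcR -complex_nonneg//; exact: ltW.
apply: filterS (filterI (Fa _ Re0) (Fb _ Re0)) => x [ax bx].
apply: le_lt_trans (normc_le_ReIm _) _.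
rewrite [ltRHS]complex_nonneg ?ltW// ltcR (splitr (complex.Re e)).
by case: x ax bx => c d /= ax bx; exact: ltrD.
Qed.

Lemma complex_hilbert_scalars : hilbert_scalars (K := C) Num.conj.
Proof.
split.
- move=> E M [x0 Ex0] E0 EM.
  have [||s sub slub] := @real_sup [set complex.Re x | x in E] (complex.Re M).
  + by exists (complex.Re x0), x0.
  + by move=> _ [x Ex <-]; have := EM _ Ex; rewrite lecE => /andP[].
  exists s%:C.
    by move=> x Ex; rewrite (complex_nonneg (E0 _ Ex)) lecR; apply: sub; exists x.
  move=> M' EM'.
  have M'0 : 0 <= M' by apply: le_trans (E0 _ Ex0) (EM' _ Ex0).
  rewrite (complex_nonneg M'0) lecR; apply: slub => _ [x Ex <-].
  by have := EM' _ Ex; rewrite lecE => /andP[].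
- by move=> x x0; exists (sqrtC x); rewrite ?sqrtC_ge0 ?sqrtCK.
- exact: complex_complete.
- exact: conjCK.
- exact: normCK.
Qed.

End real_and_complex_scalars.

(** * Unordered sums *)

Section unordered_sums.
Context {K : numFieldType} {V : choiceType}.
Implicit Types (x y : V -> K) (A : {fset V}).

Lemma partial_sumE x A : partial_sum x A = \sum_(v <- A) x v.
Proof. by rewrite /partial_sum big_seq_fsetE. Qed.

Lemma ler_norm_partial_sumB x y A B : (forall v, `|x v| <= y v) ->
  {subset B <= A} ->
  `|partial_sum x A - partial_sum x B| <= partial_sum y A - partial_sum y B.
Proof.
move=> xy BA; rewrite !partial_sumE.
have split z : \sum_(v <- A) z v - \sum_(v <- B) z v =
    \sum_(v <- [fset v in A | v \notin B]%fset) z v :> K.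
  rewrite (big_fsetID _ (mem B)) /= [LHS]addrC.
  suff -> : \sum_(v <- [fset v in A | v \in B]%fset) z v = \sum_(v <- B) z v.
    by rewrite addKr.
  apply: eq_fbigl => v; rewrite !inE/=.
  by apply/andP/idP => [[]//|vB]; split=> //; exact: BA.
by rewrite !split; apply: le_trans (ler_norm_sum _ _ _) _; apply: ler_sum.
Qed.

(** Comparison test: by [ler_norm_partial_sumB] the tails of x are at most those
    of y, so that the partial sums of x form a Cauchy filter. *)
Lemma dominated_partial_sum_cvg {theta : {rmorphism K -> K}} x y :
  hilbert_scalars theta -> (forall v, `|x v| <= y v) ->
  cvg (partial_sum y @ totally) -> cvg (partial_sum x @ totally).
Proof.
move=> H xy /cvg_ex[l yl]; apply: (scalar_complete H); apply: cauchy_exP => e e0.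
have [A _ Al] : totally [set A | `|l - partial_sum y A| < e / 2].
  by move/cvgrPdist_lt : yl; apply; rewrite divr_gt0.
exists (partial_sum x A); exists A => // B AB.
rewrite /= -ball_normE/= distrC.
apply: le_lt_trans (ler_norm_partial_sumB xy (fsubsetP AB)) _.
have yr C : partial_sum y C \is Num.real.
  rewrite partial_sumE; apply: rpred_sum => v _.
  by rewrite ger0_real// (le_trans _ (xy v)).
apply: le_lt_trans (real_ler_norm _) _; first by rewrite rpredB.
have -> : partial_sum y B - partial_sum y A =
    (l - partial_sum y A) - (l - partial_sum y B) by ring.
rewrite (le_lt_trans (ler_normB _ _))// [ltRHS]splitr ltrD//.
  by apply: Al; exact: fsubset_refl.
exact: Al.
Qed.

Lemma partial_sum_cvgD x y a b : partial_sum x @ totally --> a ->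
  partial_sum y @ totally --> b -> partial_sum (x + y) @ totally --> a + b.
Proof.
move=> xa yb; have -> : partial_sum (x + y) = partial_sum x + partial_sum y.
  by apply/funext => A; rewrite !fctE !partial_sumE big_split.
exact: cvgD.
Qed.

Lemma partial_sum_cvgZ x a c : partial_sum x @ totally --> a ->
  partial_sum (c *: x) @ totally --> c * a.
Proof.
move=> xa; have -> : partial_sum (c *: x) = (fun A => c * partial_sum x A).
  by apply/funext => A; rewrite !partial_sumE mulr_sumr.
by apply: cvgM => //; exact: cvg_cst.
Qed.

End unordered_sums.

(** When the index type is exhausted by A, the finite sets that contain A reduce
    to A itself. *)
Lemma partial_sum_full (K : numFieldType) (I : choiceType) (A : {fset I})
    (x : I -> K) (l : K) : (forall i, i \in A) -> \sum_(i <- A) x i = l ->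
  partial_sum x @ totally --> l.
Proof.
move=> Afull <-; apply: cvg_near_cst; exists A => // B AB; rewrite /= partial_sumE.
by apply: eq_fbigl => i; rewrite Afull (fsubsetP AB).
Qed.

(** * The Hilbert space of square summable families *)

(** Cauchy-Schwarz for two terms with weights p and q.  Summing it over an index
    set, with p and q the norms of two families, gives the triangle inequality
    of l2 with no recourse to the inner product. *)
Lemma sqrr_sum_le (K : numFieldType) (a b p q : K) : 0 <= a -> 0 <= b ->
  0 < p -> 0 < q -> (a + b) ^+ 2 <= (p + q) * (a ^+ 2 / p + b ^+ 2 / q).
Proof.
move=> a0 b0 p0 q0.
have rab : a * q - b * p \is Num.real.
  by rewrite rpredB// rpredM// ger0_real// ltW.
have pq : 0 < p * q by rewrite mulr_gt0.
rewrite -subr_ge0 -(pmulr_lge0 _ pq).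
have -> : ((p + q) * (a ^+ 2 / p + b ^+ 2 / q) - (a + b) ^+ 2) * (p * q)
    = (a * q - b * p) ^+ 2.
  by field; rewrite !gt_eqF.
exact: real_exprn_even_ge0.
Qed.

Section l2_bound.
Context {K : numFieldType} {V : choiceType}.
Implicit Types (f g : V -> K) (A : {fset V}) (M : K).

(** The norm of f in l2 is at most M, for M nonnegative.  Bounding all the finite
    sums keeps infinite sums out of the theory of the norm. *)
Definition l2_bound f M := forall A, \sum_(v <- A) `|f v| ^+ 2 <= M ^+ 2.

Lemma l2_bound_coord f M v : 0 <= M -> l2_bound f M -> `|f v| <= M.
Proof.
move=> M0 /(_ [fset v]%fset); rewrite big_seq_fset1.
by rewrite ler_pXn2r ?nnegrE.
Qed.

Lemma l2_bound0 f : l2_bound f 0 -> f = 0.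
Proof.
move=> f0; apply/funext => v; apply/eqP.
by rewrite -normr_le0; exact: l2_bound_coord.
Qed.

Lemma l2_boundD f g p q : 0 <= p -> 0 <= q -> l2_bound f p -> l2_bound g q ->
  l2_bound (f + g) (p + q).
Proof.
move=> p0 q0 fp gq A.
have [p00|pn0] := eqVneq p 0.
  by move: fp; rewrite p00 => /l2_bound0->; rewrite !add0r; exact: gq.
have [q00|qn0] := eqVneq q 0.
  by move: gq; rewrite q00 => /l2_bound0->; rewrite !addr0; exact: fp.
have {pn0}p0 : 0 < p by rewrite lt0r pn0.
have {qn0}q0 : 0 < q by rewrite lt0r qn0.
apply: (@le_trans _ _ (\sum_(v <- A)
    (p + q) * (`|f v| ^+ 2 / p + `|g v| ^+ 2 / q))).
  apply: ler_sum => v _; apply: le_trans (sqrr_sum_le _ _ p0 q0) => //.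
  by rewrite ler_pXn2r ?nnegrE ?addr_ge0 ?ler_normD.
rewrite -mulr_sumr big_split/= -!mulr_suml expr2 ler_pM2l ?addr_gt0//.
by apply: lerD; rewrite ler_pdivrMr// -expr2.
Qed.

Lemma l2_boundZ f M a : l2_bound f M -> l2_bound (a *: f) (`|a| * M).
Proof.
move=> fM A; rewrite exprMn.
under eq_bigr => v _ do rewrite /= normrM exprMn.
by rewrite -mulr_sumr ler_wpM2l ?exprn_ge0.
Qed.

(** Composing with an injection only selects coordinates: the sum over A of the
    composite is the sum over the image of A. *)
Lemma l2_bound_comp f g C M (sigma : V -> V) : injective sigma -> 0 <= C ->
  (forall v, `|g v| <= C * `|f (sigma v)|) -> l2_bound f M ->
  l2_bound g (C * M).
Proof.
move=> sI C0 gf fM A.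
apply: (@le_trans _ _ (\sum_(v <- A) C ^+ 2 * `|f (sigma v)| ^+ 2)).
  by apply: ler_sum => v _; rewrite -exprMn ler_pXn2r ?nnegrE ?mulr_ge0.
rewrite -mulr_sumr exprMn ler_wpM2l ?exprn_ge0//.
have := fM [fset sigma v | v in A]%fset.
by rewrite big_imfset//; move=> u v _ _; exact: sI.
Qed.

End l2_bound.

Section l2_norm_existence.
Context {K : numFieldType} {theta : {rmorphism K -> K}}.
Hypothesis H : hilbert_scalars theta.
Context {V : choiceType}.
Implicit Types f : V -> K.

Lemma l2_norm_exists f : (exists2 M, 0 <= M & l2_bound f M) ->
  exists N, [/\ 0 <= N, l2_bound f N &
    forall M, 0 <= M -> l2_bound f M -> N <= M].
Proof.
move=> [M M0 fM].
pose E := [set \sum_(v <- A) `|f v| ^+ 2 | A in [set: {fset V}]].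
have E0 x : E x -> 0 <= x.
  by move=> [A _ <-]; rewrite sumr_ge0// => v _; rewrite exprn_ge0.
have [||s sub slub] := @scalar_sup _ _ H E (M ^+ 2) _ E0.
- by exists (\sum_(v <- fset0) `|f v| ^+ 2); exists fset0.
- by move=> x [A _ <-]; exact: fM.
have s0 : 0 <= s.
  by apply: (sub 0); exists fset0 => //; rewrite big_seq_fset0.
have [N N0 Ns] := scalar_sqrt H s0; exists N; split=> // [A|M' M'0 fM'].
  by rewrite Ns; apply: sub; exists A.
rewrite -(@ler_pXn2r _ 2)// Ns; apply: slub => x [A _ <-]; exact: fM'.
Qed.

End l2_norm_existence.

Section l2_space.
Context {K : numFieldType} {theta : {rmorphism K -> K}}.
Variables (H : hilbert_scalars theta) (V : choiceType).

Definition square_summable : set (V -> K) :=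
  [set f | exists2 M, 0 <= M & l2_bound f M].

Lemma square_summable_submod_closed :
  submod_closed (fun f : V -> K => f \in square_summable).
Proof.
split.
  rewrite unfold_in inE; exists 0 => // A; rewrite big1 ?expr0n// => v _.
  by rewrite normr0 expr0n.
move=> a f g; rewrite !unfold_in !inE => -[p p0 fp] [q q0 gq].
exists (`|a| * p + q); first by rewrite addr_ge0 ?mulr_ge0.
by apply: l2_boundD => //; [rewrite mulr_ge0|exact: l2_boundZ].
Qed.

(** The proof that K is a suitable field is a parameter of the type, so that
    inference finds the norm that is built from it. *)
Definition l2 & hilbert_scalars theta : Type :=
  {f : V -> K | f \in square_summable}.

HB.instance Definition _ := [isSub of l2 H for @sval _ _].
HB.instance Definition _ := [Choice of l2 H by <:].
HB.instance Definition _ := GRing.SubChoice_isSubLmodule.Build K (V -> K)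
  (fun f => f \in square_summable) (l2 H) square_summable_submod_closed.

Implicit Types f g : l2 H.

Lemma l2_normP f : {N : K | [/\ 0 <= N, l2_bound (val f) N &
    forall M, 0 <= M -> l2_bound (val f) M -> N <= M]}.
Proof. by apply/cid/(l2_norm_exists H)/set_mem/(valP f). Qed.

Definition l2_norm f : K := sval (l2_normP f).

Lemma l2_norm_ge0 f : 0 <= l2_norm f.
Proof. by rewrite /l2_norm; case: l2_normP => ? []. Qed.

Lemma l2_norm_bound f : l2_bound (val f) (l2_norm f).
Proof. by rewrite /l2_norm; case: l2_normP => ? []. Qed.

Lemma l2_norm_le f M : 0 <= M -> l2_bound (val f) M -> l2_norm f <= M.
Proof. by rewrite /l2_norm; case: l2_normP => ? [? ? h] /=; exact: h. Qed.

Lemma l2_norm_coord f v : `|val f v| <= l2_norm f.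
Proof. exact/l2_bound_coord/l2_norm_bound/l2_norm_ge0. Qed.

Let l2_normD f g : l2_norm (f + g) <= l2_norm f + l2_norm g.
Proof.
apply: l2_norm_le; first by rewrite addr_ge0 ?l2_norm_ge0.
by apply: l2_boundD; rewrite ?l2_norm_ge0//; exact: l2_norm_bound.
Qed.

Let l2_normZ_le a f : l2_norm (a *: f) <= `|a| * l2_norm f.
Proof.
apply: l2_norm_le; first by rewrite mulr_ge0 ?l2_norm_ge0.
exact/l2_boundZ/l2_norm_bound.
Qed.

Let l2_norm_eq0 f : l2_norm f = 0 -> f = 0.
Proof.
move=> f0; apply: val_inj; apply/funext => v /=; apply/eqP.
by rewrite -normr_le0 -f0 l2_norm_coord.
Qed.

Let l2_normZ a f : l2_norm (a *: f) = `|a| * l2_norm f.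
Proof.
apply: le_anti; rewrite l2_normZ_le/=.
have [->|a0] := eqVneq a 0; first by rewrite normr0 mul0r l2_norm_ge0.
have := l2_normZ_le a^-1 (a *: f); rewrite scalerA mulVf// scale1r.
by rewrite normfV ler_pdivlMl ?normr_gt0.
Qed.

HB.instance Definition _ := Lmodule_isNormed.Build K (l2 H)
  l2_normD l2_normZ l2_norm_eq0.

Lemma l2_coordD f g v : val (f + g) v = val f v + val g v.
Proof. by []. Qed.

Lemma l2_coordZ a f v : val (a *: f) v = a * val f v.
Proof. by []. Qed.

Lemma l2_coord_le f v : `|val f v| <= `|f|.
Proof. exact: l2_norm_coord. Qed.

Lemma l2_le f M : 0 <= M -> l2_bound (val f) M -> `|f| <= M.
Proof. exact: l2_norm_le. Qed.

Lemma l2_coord_continuous v : continuous (fun f => val f v).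
Proof.
move=> f; apply/(@cvgrPdist_lt _ _ _ (nbhs f)) => e e0.
apply/nbhs_ballP; exists e => //= g; rewrite -ball_normE /=.
by apply: le_lt_trans; exact: l2_coord_le (f - g) v.
Qed.

(** The limit h is taken coordinatewise.  Bounds on finite sums pass to the limit
    in one of two Cauchy-close families, so h is near the filter in norm, and h
    is in l2 as a member of l2 minus a family bounded by 1. *)
Let l2_complete (F : set_system (l2 H)) : ProperFilter F -> cauchy F -> cvg F.
Proof.
move=> FF /cauchy_ballP cF.
have cv v : cvg ((fun f => val f v) @ F).
  apply: (scalar_complete H); apply/cauchy_ballP => e e0; near_simpl.
  apply: filterS (cF e e0) => -[f g] /=; rewrite -!ball_normE /=.
  by apply: le_lt_trans; exact: l2_coord_le (f - g) v.
pose h v : K := lim ((fun f => val f v) @ F).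
have near_h e : 0 < e -> \forall f \near F, l2_bound (val f - h) e.
  move=> e0.
  have [P [FP Pe]] : exists P, F P /\ forall f g, P f -> P g -> `|f - g| < e.
    have /(_ (e / 2))[] := cF; first by rewrite divr_gt0.
    move=> [P Q]/= [FP FQ] PQ; exists (P `&` Q); split; first exact: filterI.
    move=> f g [Pf Qf] [Pg Qg].
    have := PQ (f, g) (conj Pf Qg); rewrite -ball_normE/= => /lt_trans; apply.
    by rewrite ltr_pdivrMr// ltr_pMr// ltr1n.
  apply: (filterS _ FP) => f Pf A.
  have sum_cvg : \sum_(v <- A) `|val f v - val g v| ^+ 2 @[g --> F] -->
      \sum_(v <- A) `|val f v - h v| ^+ 2.
    apply: cvg_sumr => v.
    have : `|val f v - val g v| @[g --> F] --> `|val f v - h v|.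
      by apply: cvg_norm; apply: cvgB; [exact: cvg_cst|exact: cv].
    by move=> c; exact: (cvgM c c).
  have sum_real (k : V -> K) : \sum_(v <- A) `|k v| ^+ 2 \is Num.real.
    by apply: rpred_sum => v _; rewrite rpredX ?normr_real.
  apply: (cvg_real_le _ _ _ sum_cvg) => //; first by rewrite rpredX// gtr0_real.
  apply: filterS FP => g Pg; apply: (@le_trans _ _ (`|f - g| ^+ 2)).
    exact: (l2_norm_bound (f - g)).
  by rewrite ler_pXn2r ?nnegrE ?normr_ge0 ?(ltW e0)// ltW// Pe.
have [f fh] := filter_ex (near_h 1 ltr01).
have hl2 : h \in square_summable.
  rewrite inE; exists (`|f| + 1); first by rewrite addr_ge0.
  have -> : h = val f + - (val f - h) by rewrite opprB addrC subrK.
  apply: l2_boundD => //; first exact: l2_norm_bound.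
  have := l2_boundZ (-1) fh; rewrite normrN1 mul1r scaleN1r; exact.
apply/cvg_ex; exists (Sub h hl2 : l2 H).
apply/cvgrPdist_le => e e0; near=> g.
rewrite -normrN opprB; apply: l2_le; first exact: ltW.
by near: g; exact: near_h.
Unshelve. all: by end_near. Qed.

HB.instance Definition _ := Uniform_isComplete.Build (l2 H) l2_complete.

Definition l2_coords : l2 H -> (V -> K) := val.

HB.instance Definition _ := GRing.Linear.on l2_coords.

Lemma l2_coords_continuous : continuous (l2_coords : l2 H -> {ptws V -> K}).
Proof.
move=> f; have FF : Filter (l2_coords @ nbhs f) by exact: fmap_filter.
apply/(@cvg_sup _ _ _ _ _ FF) => v; apply/(@cvg_image _ _ _ _ _ FF).
  rewrite eqEsubset; split=> // c _; by exists (fun=> c).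
move=> A /(@l2_coord_continuous v f) fA.
exists ((fun h : V -> K => h v) @^-1` A); first exact: fA.
rewrite eqEsubset; split=> [c [h Ah <-]//|c Ac]; by exists (fun=> c).
Qed.

Definition l2_sequence_space : banach_sequence_space K V :=
  @BanachSequenceSpace K V (l2 H) l2_coords val_inj l2_coords_continuous.

End l2_space.

Section l2_delta.
Context {K : numFieldType} {theta : {rmorphism K -> K}}.
Variables (H : hilbert_scalars theta) (V : choiceType).

Let delta (v w : V) : K := (w == v)%:R.

Let delta_bound v : l2_bound (delta v) 1.
Proof.
move=> A; rewrite expr1n; have [vA|vA] := boolP (v \in A).
  rewrite (big_fsetD1 v)//= /delta eqxx normr1 expr1n big1_fset ?addr0// => w.
  by rewrite !inE => /andP[/negbTE-> _]; rewrite normr0 expr0n.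
rewrite big1_fset// => w wA _; rewrite /delta.
by case: eqP vA => [<-|_ _]; rewrite ?wA// normr0 expr0n.
Qed.

Let delta_l2 v : delta v \in @square_summable K V.
Proof. by rewrite inE; exists 1. Qed.

Definition l2_delta v : l2 V H := Sub (delta v) (delta_l2 v).

Lemma l2_deltaE v w : val (l2_delta v) w = (w == v)%:R.
Proof. by []. Qed.

Lemma l2_delta_le1 v : `|l2_delta v| <= 1.
Proof. by apply: l2_le => //; exact: delta_bound. Qed.

End l2_delta.

Section l2_dot.
Context {K : numFieldType} {theta : {rmorphism K -> K}}.
Variables (H : hilbert_scalars theta) (V : choiceType).
Implicit Types f g : l2 V H.

(** The finite sums increase to their supremum; otherwise the square root of
    |f|^2 - e would be a smaller bound than the norm. *)
Lemma l2_norm_partial_sum_cvg f :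
  partial_sum (fun v => `|val f v| ^+ 2) @ totally --> `|f| ^+ 2.
Proof.
apply/cvgrPdist_lt => e e0.
have real_sum A : \sum_(v <- A) `|val f v| ^+ 2 \is Num.real.
  by apply: rpred_sum => v _; rewrite rpredX ?normr_real.
have [A Ae] : exists A : {fset V}, `|f| ^+ 2 - e < \sum_(v <- A) `|val f v| ^+ 2.
  have [nn|nn] := boolP (0 <= `|f| ^+ 2 - e); last first.
    exists fset0; rewrite big_seq_fset0 real_ltNge//.
    by rewrite rpredB ?rpredX ?normr_real// gtr0_real.
  apply: contrapT => /forallNP small.
  have [N N0 NE] := scalar_sqrt H nn.
  have : `|f| <= N.
    apply: l2_le => // A; rewrite NE real_leNgt//; first exact/negP/small.
    by rewrite ger0_real.
  rewrite -(@ler_pXn2r _ 2) ?nnegrE// NE lerBrDr gerDl.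
  by move=> /le_lt_trans/(_ e0); rewrite ltxx.
exists A => // B AB; rewrite /= partial_sumE ger0_norm ?subr_ge0; last first.
  exact: (l2_norm_bound f).
rewrite ltrBlDr -ltrBlDl; apply: lt_le_trans Ae _.
have := @ler_norm_partial_sumB _ _ (fun=> 0) (fun v => `|val f v| ^+ 2) B A.
rewrite !partial_sumE => /(_ _ (fsubsetP AB)) sumB.
rewrite -subr_ge0; apply: le_trans (sumB _); first exact: normr_ge0.
by move=> v; rewrite normr0 exprn_ge0.
Qed.

Definition l2_dot f g : K :=
  lim (partial_sum (fun v => val f v * theta (val g v)) @ totally).

(** The products are dominated by |f v|^2 + |g v|^2, which is summable. *)
Lemma l2_dot_cvg f g : partial_sum (fun v => val f v * theta (val g v)) @ totally
  --> l2_dot f g.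
Proof.
have := partial_sum_cvgD (l2_norm_partial_sum_cvg (f := f))
  (l2_norm_partial_sum_cvg (f := g)).
move=> /cvgP; apply: (dominated_partial_sum_cvg H) => v.
rewrite normrM (norm_conj H) !fctE.
set a := `|val f v|; set b := `|val g v|.
have : 0 <= (a - b) ^+ 2 by rewrite real_exprn_even_ge0// rpredB ?normr_real.
have : 0 <= a * b by rewrite mulr_ge0 ?normr_ge0.
rewrite sqrrB => ab; rewrite addrAC subr_ge0; apply: le_trans.
by rewrite mulr2n lerDl.
Qed.

Lemma l2_dot_unique f g c :
  partial_sum (fun v => val f v * theta (val g v)) @ totally --> c ->
  l2_dot f g = c.
Proof. exact: norm_cvg_unique (l2_dot_cvg (f := f) (g := g)). Qed.

Lemma l2_dotPl a f1 f2 g : l2_dot (a *: f1 + f2) g = a * l2_dot f1 g + l2_dot f2 g.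
Proof.
apply: l2_dot_unique.
rewrite (_ : (fun v => _) = a *: (fun v => val f1 v * theta (val g v)) +
  (fun v => val f2 v * theta (val g v))).
  by apply: partial_sum_cvgD; [apply: partial_sum_cvgZ|]; exact: l2_dot_cvg.
by apply/funext => v; rewrite [LHS]mulrDl -mulrA.
Qed.

Lemma l2_dotC f g : l2_dot f g = theta (l2_dot g f).
Proof.
apply: l2_dot_unique; apply/cvgrPdist_lt => e e0.
have /cvgrPdist_lt/(_ e e0) := @l2_dot_cvg g f.
apply: filterS => A; rewrite -(norm_conj H (_ - _)) rmorphB.
congr (`| _ - _ | < _).
rewrite !partial_sumE rmorph_sum; apply: eq_bigr => v _.
by rewrite rmorphM (scalar_conjK H) mulrC.
Qed.

Lemma l2_dotPr a f g1 g2 :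
  l2_dot f (a *: g1 + g2) = theta a * l2_dot f g1 + l2_dot f g2.
Proof. by rewrite l2_dotC l2_dotPl rmorphD rmorphM -!l2_dotC. Qed.

Lemma l2_dotE f : l2_dot f f = `|f| ^+ 2.
Proof.
apply: l2_dot_unique; under eq_fun do rewrite -(scalar_normE H).
exact: l2_norm_partial_sum_cvg.
Qed.

Lemma l2_is_hilbert : is_hilbert theta (l2 V H).
Proof.
have dotBl g : zmod_morphism (l2_dot^~ g).
  by move=> f1 f2; rewrite addrC -scaleN1r l2_dotPl mulN1r addrC.
have dotBr f : zmod_morphism (l2_dot f).
  by move=> g1 g2; rewrite addrC -scaleN1r l2_dotPr rmorphN1 mulN1r addrC.
have dot0l g : l2_dot 0 g = 0 by rewrite -(subrr 0) dotBl subrr.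
have dot0r f : l2_dot f 0 = 0 by rewrite -(subrr 0) dotBr subrr.
have dotZl g : scalable_for *%R (l2_dot^~ g).
  by move=> a f; rewrite -[a *: f]addr0 l2_dotPl dot0l addr0.
have dotZr f : scalable_for (theta \; *%R) (l2_dot f).
  by move=> a g; rewrite -[a *: g]addr0 l2_dotPr dot0r addr0.
have dotC f g : l2_dot f g = (-1) ^+ false * theta (l2_dot g f).
  by rewrite mul1r -l2_dotC.
have dot_gt0 f : f != 0 -> 0 < l2_dot f f.
  by move=> f0; rewrite l2_dotE exprn_gt0// normr_gt0.
pose B := isBilinear.Build _ _ _ _ _ _ _ dotBl dotBr dotZl dotZr.
pose C := isHermitianSesquilinear.Build _ _ _ _ _ dotC.
pose D := isDotProduct.Build _ _ _ dot_gt0.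
pose dot : {dot l2 V H for theta} := HB.pack l2_dot B C D.
by exists dot => f; rewrite -l2_dotE.
Qed.

End l2_dot.

(** * Chain recurrence *)

Section chains.
Context {K : numFieldType} {X : normedModType K}.

(** A vector that falls onto 0, and that some orbits starting arbitrarily near 0
    hit exactly, is chain recurrent: a single jump at 0 closes the loop. *)
Lemma CR_homoclinic (T : X -> X) (x : X) (p : nat) : (0 < p)%N ->
  iter p T x = 0 ->
  (forall delta : K, 0 < delta ->
    exists (y : X) (q : nat), `|y| < delta /\ iter q T y = x) ->
  CR T x.
Proof.
move=> p0 Tx from0 d d0; have [y [q [yd Ty]]] := from0 d d0.
exists (p + q)%N, (fun l => if (l < p)%N then iter l T x else iter (l - p) T y).
split; last by rewrite ltnNge leq_addr /= addKn.
- split=> [|[|l]//]; first by rewrite addn_gt0 p0.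
  move=> /= _; case: (ltngtP l.+1 p) => [lp|pl|lp] /=.
  + by rewrite subrr normr0.
  + by rewrite subSn// subrr normr0.
  + by rewrite lp subnn /= -iterS lp Tx subr0.
by rewrite p0.
Qed.

(** Errors of size |x|/4 do not compensate a loss of one half per step: a chain
    from x stays in the ball of radius |x|, and is strictly inside it from its
    first step on, so that it does not come back to x. *)
Lemma CR_contraction (T : X -> X) : (forall x, `|T x| <= `|x| / 2) ->
  CR T = [set 0].
Proof.
move=> Tle; have T0 : T 0 = 0.
  by apply/eqP; rewrite -normr_le0 (le_trans (Tle 0))// normr0 mul0r.
rewrite eqEsubset; split=> [x|_ -> d d0]; last first.
  exists 1%N, (fun=> 0); split=> //; split=> // l _.
  by rewrite T0 subr0 normr0.
move=> /CR_periodic xCR; apply/eqP; rewrite -normr_le0.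
rewrite real_leNgt ?normr_real ?real0//; apply/negP => x0.
have [|m [c [m0 c0 cper cd]]] := xCR (`|x| / 4); first by rewrite divr_gt0.
have step l : `|c l| <= `|x| -> `|c l.+1| < `|x|.
  move=> cl; rewrite -(subrK (T (c l)) (c l.+1)).
  apply: le_lt_trans (ler_normD _ _) _.
  apply: lt_le_trans (ltr_leD (cd l) (Tle _)) _.
  apply: (@le_trans _ _ (`|x| / 4 + `|x| / 2)); first by rewrite lerD2l ler_pM2r.
  rewrite -subr_ge0 (_ : _ - _ = `|x| / 4); first by rewrite divr_ge0.
  by field.
have cle l : `|c l| <= `|x| by elim: l => [|l /step/ltW//]; rewrite c0.
have := step m.-1 (cle _); rewrite prednK//.
by have := cper 0%N 1%N; rewrite add0n mul1n c0 => ->; rewrite ltxx.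
Qed.

End chains.

(** * The comb *)

Definition comb_edge (u v : nat * nat) : bool :=
  (v == (u.1, u.2.+1)) || (u.2 == 0%N) && (v == (u.1.+1, 0%N)).

(** Edges raise the level v.1 + v.2 by one, which excludes directed cycles. *)
Lemma comb_edgeP u v : comb_edge u v -> (v.1 + v.2 = (u.1 + u.2).+1)%N.
Proof.
move=> /orP[/eqP->|/andP[/eqP u0 /eqP->]] /=; first by rewrite addnS.
by rewrite u0 !addn0.
Qed.

Lemma comb_irreflexive : irreflexive comb_edge.
Proof. by move=> v; apply/negP => /comb_edgeP/n_Sn. Qed.

Lemma comb_connected (u v : nat * nat) : exists p : seq (nat * nat),
  path (fun a b => comb_edge a b || comb_edge b a) u p /\ last u p = v.
Proof.
pose adj a b := comb_edge a b || comb_edge b a.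
pose joined a b := exists p, path adj a p /\ last a p = b.
have joined_trans a b c : joined a b -> joined b c -> joined a c.
  move=> [p [pp <-]] [q [pq <-]]; exists (p ++ q).
  by rewrite cat_path pp pq last_cat.
have joined1 a b : adj a b -> joined a b by move=> ab; exists [:: b]; rewrite /= ab.
have adjC a b : adj a b = adj b a by rewrite /adj orbC.
suff joined0 w : joined w (0, 0)%N /\ joined (0, 0)%N w.
  exact: joined_trans (joined0 u).1 (joined0 v).2.
have step a b : adj a b -> joined a (0, 0)%N /\ joined (0, 0)%N a ->
    joined b (0, 0)%N /\ joined (0, 0)%N b.
  move=> ab [a0 oa]; split; last exact: joined_trans oa (joined1 _ _ ab).
  by apply: joined_trans a0; apply: joined1; rewrite adjC.
case: w => n k; elim: k => [|k IHk]; last first.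
  by apply: step IHk; rewrite /adj /comb_edge eqxx.
elim: n => [|n IHn]; first by split; exists [::].
by apply: step IHn; rewrite /adj /comb_edge /= eqxx orbT.
Qed.

Lemma comb_acyclic (c : seq (nat * nat)) : ucycle comb_edge c -> c = [::].
Proof.
have path_lt p u : path comb_edge u p ->
    (u.1 + u.2 + size p = (last u p).1 + (last u p).2)%N.
  elim: p u => [|v p IHp] u /=; first by rewrite addn0.
  by move=> /andP[/comb_edgeP uv /IHp <-]; rewrite uv addSnnS.
case: c => // u p /andP[/path_lt + _]; rewrite last_rcons size_rcons.
by move=> /eqP; rewrite -[X in _ == X]addn0 eqn_add2l.
Qed.

Lemma comb_parent_unique (v w w' : nat * nat) :
  comb_edge w v -> comb_edge w' v -> w = w'.
Proof.
case: v w w' => n k [a b] [c d]; rewrite /comb_edge /=.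
by move=> /orP[/eqP e|/andP[/eqP e /eqP e']]
  /orP[/eqP e''|/andP[/eqP e'' /eqP e''']]; congruence.
Qed.

Lemma comb_root_unique (v v' : nat * nat) : (forall w, ~~ comb_edge w v) ->
  (forall w, ~~ comb_edge w v') -> v = v'.
Proof.
suff root u : (forall w, ~~ comb_edge w u) -> u = (0, 0)%N.
  by move=> /root-> /root->.
case: u => n [|k] orphan; last first.
  by have := orphan (n, k); rewrite /comb_edge eqxx.
case: n orphan => // n orphan.
by have := orphan (n, 0%N); rewrite /comb_edge /= eqxx orbT.
Qed.

Definition comb : directed_tree :=
  @DirectedTree (nat * nat)%type comb_edge comb_irreflexive comb_connected
    comb_acyclic comb_parent_unique comb_root_unique.

(** * The weighted shift on the comb *)

Section comb_shift.
Context {K : numFieldType} {theta : {rmorphism K -> K}}.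
Variable H : hilbert_scalars theta.

Local Notation V := (nat * nat)%type.
Local Notation X := (l2 V H).
Implicit Types (f g : X) (n k : nat).

(** The zero weights above height n cut the n-th tooth, which is what makes the
    shift nilpotent there; the cut teeth stay in the comb so that the tree is
    all of nat * nat. *)
Definition comb_weight (v : comb) : K :=
  if v.2 == 0%N then 2^-1 else if (v.2 <= v.1)%N then 4 else 0.

(** The shift is the sum of its contributions from the two kinds of children.
    Each of them is a bounded multiple of a composition with an injection, so
    that [l2_bound_comp] applies. *)
Definition comb_tooth (f : V -> K) (v : V) : K :=
  comb_weight (v.1, v.2.+1) * f (v.1, v.2.+1).

Definition comb_spine (f : V -> K) (v : V) : K :=
  (if v.2 == 0%N then 2^-1 else 0) * f (v.1.+1, v.2).

Lemma comb_tooth_bound (f : V -> K) M : l2_bound f M -> l2_bound (comb_tooth f) (4 * M).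
Proof.
apply: (@l2_bound_comp _ _ _ _ _ _ (fun v => (v.1, v.2.+1))) => //.
  by move=> [n k] [m l] /= [-> ->].
move=> [n k]; rewrite normrM ler_wpM2r// /comb_weight /=.
by case: ifP => _; rewrite ger0_norm.
Qed.

Lemma comb_spine_bound (f : V -> K) M :
  l2_bound f M -> l2_bound (comb_spine f) (2^-1 * M).
Proof.
apply: (@l2_bound_comp _ _ _ _ _ _ (fun v => (v.1.+1, v.2))) => //.
  by move=> [n k] [m l] /= [-> ->].
move=> [n k]; rewrite normrM ler_wpM2r//=.
by case: ifP => _; rewrite ?normr0 ?invr_ge0 ?ger0_norm ?invr_ge0.
Qed.

Lemma comb_shift_subproof f :
  comb_tooth (val f) + comb_spine (val f) \in square_summable (K := K) (V := V).
Proof.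
rewrite inE; exists (4 * `|f| + 2^-1 * `|f|).
  by rewrite addr_ge0// mulr_ge0 ?invr_ge0.
by apply: l2_boundD; rewrite ?mulr_ge0 ?invr_ge0//;
  [apply: comb_tooth_bound|apply: comb_spine_bound]; exact: l2_norm_bound.
Qed.

Definition comb_shift f : X :=
  Sub (comb_tooth (val f) + comb_spine (val f)) (comb_shift_subproof f).

Lemma comb_shiftE f v :
  val (comb_shift f) v = comb_tooth (val f) v + comb_spine (val f) v.
Proof. by []. Qed.

Let comb_shift_linear : linear comb_shift.
Proof.
move=> a f g; apply: val_inj; apply/funext => v.
rewrite [RHS]l2_coordD l2_coordZ 3!comb_shiftE /comb_tooth /comb_spine.
by rewrite !l2_coordD !l2_coordZ; ring.
Qed.

HB.instance Definition _ := GRing.isLinear.Build K X X _ comb_shift comb_shift_linear.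

Lemma comb_shift_le f : `|comb_shift f| <= (4 + 2^-1) * `|f|.
Proof.
rewrite mulrDl; apply: l2_le; first by rewrite addr_ge0// mulr_ge0 ?invr_ge0.
by apply: l2_boundD; rewrite ?mulr_ge0 ?invr_ge0//;
  [apply: comb_tooth_bound|apply: comb_spine_bound]; exact: l2_norm_bound.
Qed.

Let comb_shift_continuous : continuous comb_shift.
Proof.
apply: bounded_linear_continuous; apply/linear_boundedP.
near=> r => f; apply: le_trans (comb_shift_le f) _.
by rewrite ler_wpM2r//; near: r; exact: nbhs_pinfty_ge.
Unshelve. all: by end_near. Qed.

HB.instance Definition _ := isContinuous.Build X X comb_shift comb_shift_continuous.

Lemma comb_shift_weighted :
  is_weighted_backward_shift (V := comb) (X := l2_sequence_space H V)
    comb_weight comb_shift.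
Proof.
move=> f [n k]; rewrite [coords _ _ _]comb_shiftE /comb_tooth /comb_spine /=.
have tooth_child : Chi ((n, k) : comb) (n, k.+1).
  by rewrite /Chi /= /comb_edge eqxx.
pose t : {u : comb | Chi ((n, k) : comb) u} :=
  Sub ((n, k.+1) : comb) tooth_child.
have [k0|k0] := eqVneq k 0%N.
  have spine_child : Chi ((n, k) : comb) (n.+1, 0%N).
    by rewrite /Chi /= /comb_edge/= k0 !eqxx orbT.
  pose s : {u : comb | Chi ((n, k) : comb) u} :=
    Sub ((n.+1, 0%N) : comb) spine_child.
  have full u : u \in [fset t; s]%fset.
    case: u => u uP; rewrite !inE -!val_eqE /=; move: (uP).
    by rewrite /Chi /= /comb_edge /= k0.
  apply: (partial_sum_full full).
  rewrite big_fsetU1 ?big_seq_fset1 /=; last first.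
    by rewrite inE -val_eqE /= xpair_eqE andbF.
  by rewrite k0.
have full u : u \in [fset t]%fset.
  case: u => u uP; rewrite !inE -!val_eqE /=; move: (uP).
  by rewrite /Chi /= /comb_edge /= (negbTE k0) orbF.
apply: (partial_sum_full full).
by rewrite big_seq_fset1 /= mul0r addr0.
Qed.

End comb_shift.

(** * Chain recurrent vectors of the shift *)

Section comb_chain_recurrence.
Context {K : numFieldType} {theta : {rmorphism K -> K}}.
Variable H : hilbert_scalars theta.

Local Notation X := (l2 (nat * nat)%type H).
Local Notation T := (@comb_shift K theta H).
Local Notation e := (@l2_delta K theta H (nat * nat)%type).

Lemma comb_shift_delta_tooth n k : (k < n)%N ->
  T (e (n, k.+1)) = 4 *: e (n, k).
Proof.
move=> kn; apply: val_inj; apply/funext => -[m l].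
rewrite comb_shiftE l2_coordZ /comb_tooth /comb_spine /comb_weight.
rewrite !l2_deltaE /= !xpair_eqE eqSS.
have -> : (if l == 0%N then 2^-1 else 0) * ((m.+1 == n) && (l == k.+1))%:R = 0 :> K.
  by case: l => [|l]; rewrite ?andbF ?mulr0 ?mul0r.
rewrite addr0; have [->|_] := eqVneq m n; last by rewrite !mulr0.
by have [->|_] := eqVneq l k; rewrite ?kn ?mulr0.
Qed.

Lemma comb_shift_delta_spine n : T (e (n.+1, 0%N)) = 2^-1 *: e (n, 0%N).
Proof.
apply: val_inj; apply/funext => -[m l].
rewrite comb_shiftE l2_coordZ /comb_tooth /comb_spine /comb_weight.
rewrite !l2_deltaE /= !xpair_eqE eqSS andbF mulr0 add0r.
by have [_|_] := eqVneq l 0%N; rewrite ?andbF ?mulr0 ?mul0r.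
Qed.

Lemma comb_shift_delta_root : T (e (0%N, 0%N)) = 0.
Proof.
apply: val_inj; apply/funext => -[m l].
rewrite comb_shiftE /comb_tooth /comb_spine !l2_deltaE !xpair_eqE /=.
by rewrite andbF !mulr0 addr0.
Qed.

Let iterZ p a (f : X) : iter p T (a *: f) = a *: iter p T f.
Proof. by elim: p => //= p ->; rewrite linearZ. Qed.

Lemma iter_comb_shift_tooth n k : (k <= n)%N ->
  iter k T (e (n, k)) = 4 ^+ k *: e (n, 0%N).
Proof.
elim: k => [|k IHk] kn; first by rewrite expr0 scale1r.
by rewrite iterSr comb_shift_delta_tooth// iterZ IHk ?scalerA ?exprS// ltnW.
Qed.

Lemma iter_comb_shift_spine m p :
  iter p T (e (m + p, 0)%N) = 2^-1 ^+ p *: e (m, 0%N).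
Proof.
elim: p => [|p IHp]; first by rewrite addn0 expr0 scale1r.
by rewrite iterSr addnS comb_shift_delta_spine iterZ IHp scalerA -exprS.
Qed.

Lemma iter_comb_shift_spine_eq0 m : iter m.+1 T (e (m, 0)%N) = 0.
Proof.
rewrite iterS -[X in e (X, _)]add0n iter_comb_shift_spine linearZ/=.
by rewrite comb_shift_delta_root scaler0.
Qed.

(** With n = m + p, the small vector is 2^p / 4^n e_(n,n): the shift takes it to
    2^p e_(n,0) in n steps, and then to e_(m,0) in p steps. *)
Lemma comb_spine_chain_recurrent m : CR T (e (m, 0%N)).
Proof.
apply: (@CR_homoclinic _ _ _ _ m.+1) => //.
  exact: iter_comb_shift_spine_eq0.
move=> d d0; have dV0 : 0 <= d^-1 by rewrite invr_ge0 ltW.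
have [p dp] := exp2_unbounded H dV0.
exists ((2 ^+ p / 4 ^+ (m + p)) *: e (m + p, m + p)%N), (p + (m + p))%N; split.
  rewrite normrZ; apply: (@le_lt_trans _ _ (2 ^- p)); last first.
    by rewrite -[d]invrK ltf_pV2// posrE ?invr_gt0 ?exprn_gt0.
  rewrite -[leRHS]mulr1 ler_pM// ?l2_delta_le1//.
  rewrite ger0_norm ?divr_ge0 ?exprn_ge0// ler_pdivrMr ?exprn_gt0//.
  rewrite ler_pdivlMl ?exprn_gt0// -exprMn (_ : 2 * 2 = 4); last by rewrite -natrM.
  by rewrite exprD ler_peMl ?exprn_ge0// exprn_ege1// (ler_nat _ 1 4).
rewrite iterD iterZ iter_comb_shift_tooth// scalerA divfK ?expf_neq0//.
rewrite iterZ iter_comb_shift_spine scalerA exprVn divff ?expf_neq0//.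
exact: scale1r.
Qed.

(** Along a periodic chain each vector is the image of another one up to d, so
    that a coordinate (n,i+1) is at most d plus 4 times a coordinate (n,i+2), and
    at most d if i >= n because of the zero weight.  Descending the tooth, the
    coordinates are at most a constant times d, and d is arbitrary. *)
Lemma CR_comb_shift_tooth (f : X) n k : CR T f -> val f (n, k.+1) = 0.
Proof.
move=> /CR_periodic fCR; apply/eqP; rewrite -normr_le0.
rewrite real_leNgt ?normr_real ?real0//; apply/negP => f0.
(* 5 ^+ j solves a_(j+1) >= 4 a_j + 1, a_0 >= 1; d makes a_n d < |f(n,k+1)|. *)
pose d : K := `|val f (n, k.+1)| / 2 / 5 ^+ n.
have d0 : 0 < d by rewrite !divr_gt0// exprn_gt0.
have [m [c [m0 c0 cper cd]]] := fCR d d0.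
(* Periodicity gives a predecessor to every term of the chain, even to c 0. *)
have step i l : `|val (c l) (n, i.+1)| <= d +
    `|comb_weight ((n, i.+2) : comb) : K| * `|val (c (l + m.-1)%N) (n, i.+2)|.
  have -> : c l = c (l + m.-1).+1.
    by rewrite -(cper l 1%N) mul1n -addnS prednK.
  set u := c (l + m.-1)%N; rewrite -[c _.+1](subrK (T u)).
  apply: le_trans (ler_normD _ _) _; apply: lerD.
    exact: le_trans (l2_coord_le _ _) (ltW (cd _)).
  by rewrite comb_shiftE /comb_tooth /comb_spine /= mul0r addr0 normrM.
have bound j i l : (n <= i + j)%N -> `|val (c l) (n, i.+1)| <= 5 ^+ j * d.
  elim: j i l => [|j IHj] i l nij; apply: le_trans (step i l) _.
    rewrite /comb_weight /= leqNgt ltnS (leq_trans nij) ?addn0//.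
    by rewrite normr0 mul0r addr0 mul1r.
  apply: (@le_trans _ _ (d + 4 * (5 ^+ j * d))).
    rewrite lerD2l ler_pM//; last by apply: IHj; rewrite addSnnS.
    by rewrite /comb_weight /=; case: ifP => _; rewrite ger0_norm.
  rewrite exprS -mulrA (_ : 5 * _ = 5 ^+ j * d + 4 * (5 ^+ j * d)); last by ring.
  rewrite lerD2r ler_peMl//; first exact: ltW.
  by rewrite exprn_ege1// (ler_nat _ 1 5).
have := bound n k 0%N (leq_addl _ _); rewrite c0 /d mulrC divfK ?expf_neq0//.
by rewrite ler_pdivlMr// ger_pMr// (ler_nat _ 2 1).
Qed.

(** Chain recurrent vectors live on the spine, where only the weights 1/2 act. *)
Lemma CR_restr_comb_shift : CR (CR_restr T) = [set 0].
Proof.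
apply: CR_contraction => g; rewrite !CR_space_normE /=.
have gCR : CR T (val g) by apply/set_mem/(valP g).
rewrite mulrC; apply: l2_le; first by rewrite mulr_ge0 ?invr_ge0.
have -> : val (T (val g)) = comb_spine (val (val g)).
  apply/funext => v; rewrite comb_shiftE /comb_tooth.
  by rewrite CR_comb_shift_tooth// mulr0 add0r.
exact/comb_spine_bound/l2_norm_bound.
Qed.

Definition comb_spine_vector m : CR_space T :=
  Sub (e (m, 0%N)) (mem_set (comb_spine_chain_recurrent m)).

Lemma comb_CR_restr_not_recurrent : ~ chain_recurrent_operator (CR_restr T).
Proof.
rewrite /chain_recurrent_operator CR_restr_comb_shift => all0.
have : [set: CR_space T] (comb_spine_vector 0) by [].
rewrite -all0 => spine0.
have : val (e (0, 0)%N) (0, 0)%N = 0.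
  by rewrite -[e _]/(val (comb_spine_vector 0)) spine0.
by rewrite l2_deltaE eqxx => /eqP; rewrite oner_eq0.
Qed.

Let CR_coord v (g : CR_space T) : K := val (val g : X) v.

Let CR_coordD v : {morph CR_coord v : g h / g + h}.
Proof.
move=> g h; have valD : val (g + h) = val g + val h :> X by exact: raddfD.
by apply: etrans (congr1 (fun f : X => val f v) valD) _; exact: l2_coordD.
Qed.

Let CR_coordZ v a : {morph CR_coord v : g / a *: g >-> a * g}.
Proof.
move=> g; have valZ : val (a *: g) = a *: val g :> X by exact: linearZ.
by apply: etrans (congr1 (fun f : X => val f v) valZ) _; exact: l2_coordZ.
Qed.

Let CR_coord0 v : CR_coord v 0 = 0.
Proof.
have val0 : val (0 : CR_space T) = 0 :> X by exact: raddf0.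
by apply: etrans (congr1 (fun f : X => val f v) val0) _.
Qed.

(** If n vectors spanned, the spine coordinates of e_(0,0), ..., e_(n,0) would
    write the identity matrix of size n+1 as a product through dimension n. *)
Lemma comb_CR_infinite_dimensional : ~ finite_dimensional (CR_space T).
Proof.
move=> [n [b span]].
have [a aE] := choice (fun j : 'I_n.+1 => span (comb_spine_vector j)).
pose A : 'M[K]_(n.+1, n) := \matrix_(j, i) a j i.
pose B : 'M[K]_(n, n.+1) := \matrix_(i, j) CR_coord (j : nat, 0%N) (b i).
suff : A *m B = 1%:M by move=> /mulmx1_min; rewrite ltnn.
apply/matrixP => j l; rewrite !mxE.
have -> : (j == l)%:R = CR_coord (l : nat, 0%N) (comb_spine_vector j).
  by rewrite /CR_coord l2_deltaE xpair_eqE andbT eq_sym.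
rewrite aE (big_morph _ (CR_coordD _) (CR_coord0 _)).
by apply: eq_bigr => i _; rewrite !mxE CR_coordZ.
Qed.

Lemma comb_shift_example :
  exists (V : directed_tree) (X : banach_sequence_space K V)
         (lambda : V -> K) (B : {continuous_linear X -> X}),
    [/\ is_hilbert theta X,
        is_weighted_backward_shift lambda B,
        ~ chain_recurrent_operator (CR_restr B),
        ~ finite_dimensional (CR_space B)
      & CR (CR_restr B) = [set 0]].
Proof.
exists comb, (l2_sequence_space H (nat * nat)%type), (@comb_weight K), T.
split.
- exact: l2_is_hilbert.
- exact: comb_shift_weighted.
- exact: comb_CR_restr_not_recurrent.
- exact: comb_CR_infinite_dimensional.
- exact: CR_restr_comb_shift.
Qed.

End comb_chain_recurrence.

Theorem theorem3p1 (R : realType) :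
  let claim (K : numFieldType) (theta : K -> K) : Prop :=
    exists (V : directed_tree) (X : banach_sequence_space K V)
           (lambda : V -> K) (B : {continuous_linear X -> X}),
      [/\ is_hilbert theta X,
          is_weighted_backward_shift lambda B,
          ~ chain_recurrent_operator (CR_restr B),
          ~ finite_dimensional (CR_space B)
        & CR (CR_restr B) = [set 0]] in
  claim R idfun /\ claim R[i] Num.conj.
Proof.
split.
- exact: (comb_shift_example (real_hilbert_scalars R)).
- exact: (comb_shift_example (complex_hilbert_scalars R)).
Qed.
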